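(* Let $n$ be a positive integer and let $1\le i<j<k\le n$. For every Eulerian poset $P$ of rank $n+1$, $$f_{\{i,k\}}(P)-2f_{\{i\}}(P)-2f_{\{k\}}(P)+2f_{\{j\}}(P)\ge 0.$$
   Context: A graded poset is a finite partially ordered set $P$ with a unique minimum $\hat 0$, a unique maximum $\hat 1$, and a rank function $\rho:P\to\mathbf{N}$ with $\rho(\hat 0)=0$ and $\rho(y)-\rho(x)=1$ whenever $y$ covers $x$. The rank of $P$ is $\rho(\hat 1)$. For $P$ of rank $n+1$ and $S\subseteq [1,n]=\{1,\dots,n\}$, $f_S(P)$ is the number of chains $x_1<\cdots<x_{|S|}$ in $P$ with $\{\rho(x_1),\dots,\rho(x_{|S|})\}=S$. A graded poset is Eulerian if the Möbius function of every interval $[x,y]$ satisfies $\mu([x,y])=(-1)^{\rho(y)-\rho(x)}$. *)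

(* Defs.v *)
From mathcomp Require Import all_boot all_order all_algebra finmap.

Set Implicit Arguments.
Unset Strict Implicit.
Unset Printing Implicit Defensive.

Import Order.TTheory GRing.Theory Num.Theory.
Local Open Scope ring_scope.

Definition covers (d : Order.disp_t) (P : finPOrderType d) (y x : P) : bool :=
  (x < y)%O && [forall z : P, ~~ (x < z < y)%O].

(* A rank function on a finite bounded poset is unique when it exists. *)
Definition rank_function (d : Order.disp_t) (P : finTBPOrderType d)
    (rho : P -> nat) : Prop :=
  rho \bot%O = 0%N /\ forall x y : P, covers y x -> rho y = (rho x).+1.

(* The number of chains x_1 < ... < x_|S| whose set of ranks is S; a chain is
   the strictly increasing tuple of its elements. *)
Definition flag_f (d : Order.disp_t) (P : finPOrderType d) (rho : P -> nat)
    (S : {fset nat}) : nat :=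
  #|[set c : #|` S|.-tuple P |
      sorted <%O (c : seq P) && ([fset rho x | x in (c : seq P)]%fset == S)]|.

(* The fuel m bounds the recursion depth; #|P| is enough by mobius_lt. *)
Fixpoint mobius_rec (d : Order.disp_t) (P : finPOrderType d) (m : nat)
    (x y : P) : int :=
  if x == y then 1 else
  if m is m'.+1 then - \sum_(z : P | (x <= z < y)%O) mobius_rec m' x z else 0.

Definition mobius (d : Order.disp_t) (P : finPOrderType d) (x y : P) : int :=
  mobius_rec #|P| x y.

Lemma mobius_refl (d : Order.disp_t) (P : finPOrderType d) (x : P) :
  mobius x x = 1.
Proof. by rewrite /mobius; case: #|P| => [|m] /=; rewrite eqxx. Qed.

Lemma mobius_rec_fuel (d : Order.disp_t) (P : finPOrderType d) (m1 m2 : nat)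
    (x y : P) :
  (#|[set z : P | (x <= z < y)%O]| <= m1)%N ->
  (#|[set z : P | (x <= z < y)%O]| <= m2)%N ->
  mobius_rec m1 x y = mobius_rec m2 x y.
Proof.
have empty z : #|[set t : P | (x <= t < z)%O]| = 0%N ->
    forall F : P -> int, \sum_(t : P | (x <= t < z)%O) F t = 0.
  move=> /eqP; rewrite cards_eq0 => /eqP E F; rewrite big_pred0 // => t.
  by have := in_set0 t; rewrite -E inE.
elim: m1 m2 y => [|m1 IH] [|m2] y //=.
- rewrite leqn0 => /eqP /empty E _.
  by case: (x == y) => //; rewrite E oppr0.
- move=> _; rewrite leqn0 => /eqP /empty E.
  by case: (x == y) => //; rewrite E oppr0.
move=> h1 h2; case: (x == y) => //; congr (- _).
apply: eq_bigr => z /andP[xz zy].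
have lt_card : (#|[set t : P | (x <= t < z)%O]| <
                #|[set t : P | (x <= t < y)%O]|)%N.
  apply: proper_card; apply/properP; split.
    apply/subsetP => t; rewrite !inE => /andP[-> tz] /=.
    exact: lt_trans tz zy.
  by exists z; rewrite !inE ?xz ?zy // ltxx andbF.
by apply: IH; rewrite -ltnS; [apply: leq_trans h1|apply: leq_trans h2].
Qed.

Lemma mobius_lt (d : Order.disp_t) (P : finPOrderType d) (x y : P) :
  (x < y)%O -> mobius x y = - \sum_(z : P | (x <= z < y)%O) mobius x z.
Proof.
move=> xy; rewrite /mobius.
rewrite (@mobius_rec_fuel _ _ _ #|P|.+1); first last.
- exact: leq_trans (max_card _) (leqnSn _).
- exact: max_card.
by rewrite /= lt_eqF.
Qed.

(* The truncated difference of ranks is the true one: x <= y forces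
   rho x <= rho y for a rank function. *)
Definition eulerian (d : Order.disp_t) (P : finTBPOrderType d)
    (rho : P -> nat) : Prop :=
  rank_function rho /\
  forall x y : P, (x <= y)%O -> mobius x y = (-1) ^+ (rho y - rho x).

(* Main.v *)
(** View every element [y] of rank [j] as the complete bipartite graph joining
    the elements of rank [i] below [y] to those of rank [k] above [y].  Rank-two
    intervals of an Eulerian poset have exactly two middle elements, so both
    sides of each such graph have at least two vertices, and every vertex lies
    in at least two of the graphs.  Put
      Phi = #edges - 2 #vertices + 2 #graphs
    for the union of a subfamily, and add the graphs one at a time, choosing
    whenever possible a graph which meets the previous ones.  A graph that
    starts a new component changes [Phi] by at least -2, a graph meeting the
    previous ones never decreases it, and the last graph of a component
    brings no new vertex, hence adds at least 2.  So [Phi] is nonnegative at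
    the end, where it is at most the quantity of the theorem. *)
Require Import Defs.
From mathcomp Require Import all_boot all_order all_algebra finmap zify.

Set Implicit Arguments.
Unset Strict Implicit.
Unset Printing Implicit Defensive.

Import Order.TTheory GRing.Theory Num.Theory.
Local Open Scope ring_scope.

(** * Counting vertices and edges in a family of complete bipartite graphs *)

Section BicliqueCover.
Local Open Scope nat_scope.
Variables (T U V : finType) (A : T -> {set U}) (B : T -> {set V}).

Definition lefts (Y : {set T}) : {set U} := \bigcup_(y in Y) A y.
Definition rights (Y : {set T}) : {set V} := \bigcup_(y in Y) B y.
Definition edges (Y : {set T}) : {set U * V} :=
  \bigcup_(y in Y) setX (A y) (B y).

Definition meets (y : T) (Y : {set T}) : bool :=
  (A y :&: lefts Y != set0) || (B y :&: rights Y != set0).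

(* [(a-2)(b-2) - (s-2)(t-2) + 2 >= 0], with the subtractions moved around *)
Lemma biclique_gain (a b s t : nat) :
  1 < a -> 1 < b -> s <= a -> t <= b -> 0 < s + t ->
  2 * a + 2 * b + s * t <= a * b + 2 * s + 2 * t + 2.
Proof.
case: a b => [|[|a]] // [|[|b]] // _ _.
case: s t => [|[|s]] [|[|t]] sa tb // _; nia.
Qed.

(** An edge of the new graph that occurred before has both ends among the vertices already covered.
    The converse can fail, hence only an inequality. *)
Lemma edges_setU1 (y : T) (Y : {set T}) :
  #|edges Y| + #|A y| * #|B y| <=
  #|edges (y |: Y)| + #|A y :&: lefts Y| * #|B y :&: rights Y|.
Proof.
rewrite {2}/edges bigcup_setU big_set1 -/(edges Y) addnC -!cardsX -cardsUI.
rewrite leq_add2l; apply/subset_leq_card/subsetP => -[u v] /setIP[].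
rewrite !inE /= => /andP[-> ->] /bigcupP[y' yY /setXP[/= uA vB]].
by apply/andP; split; apply/bigcupP; exists y'.
Qed.

Lemma lefts_setU1 (y : T) (Y : {set T}) :
  #|lefts (y |: Y)| + #|A y :&: lefts Y| = #|A y| + #|lefts Y|.
Proof. by rewrite {1}/lefts bigcup_setU big_set1 cardsUI. Qed.

Lemma rights_setU1 (y : T) (Y : {set T}) :
  #|rights (y |: Y)| + #|B y :&: rights Y| = #|B y| + #|rights Y|.
Proof. by rewrite {1}/rights bigcup_setU big_set1 cardsUI. Qed.

Variable J : {set T}.
Hypothesis A_gt1 : {in J, forall y, 1 < #|A y|}.
Hypothesis B_gt1 : {in J, forall y, 1 < #|B y|}.
Hypothesis A_shared : {in J, forall y u, u \in A y ->
  exists2 y', y' \in J :\ y & u \in A y'}.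
Hypothesis B_shared : {in J, forall y v, v \in B y ->
  exists2 y', y' \in J :\ y & v \in B y'}.

(** For [Y] inside [J]: [Y] is a union of whole connected components, possibly none. *)
Definition saturated (Y : {set T}) : bool :=
  [forall y in J :\: Y, ~~ meets y Y].

Lemma meets_left (y y' : T) (Y : {set T}) (u : U) :
  u \in A y -> y' \in Y -> u \in A y' -> meets y Y.
Proof.
move=> uy y'Y uy'; apply/orP; left; apply/set0Pn; exists u.
by rewrite inE uy; apply/bigcupP; exists y'.
Qed.

Lemma meets_right (y y' : T) (Y : {set T}) (v : V) :
  v \in B y -> y' \in Y -> v \in B y' -> meets y Y.
Proof.
move=> vy y'Y vy'; apply/orP; right; apply/set0Pn; exists v.
by rewrite inE vy; apply/bigcupP; exists y'.
Qed.

(** Each vertex of [y] lies in another graph [y'] of [J]. Were [y'] outside [Y], it would meet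
    [y |: Y] from outside, against saturation. So a graph that completes a component brings no new
    vertex. *)
Lemma saturated_setU1 (y : T) (Y : {set T}) :
  y \in J -> saturated (y |: Y) -> A y \subset lefts Y /\ B y \subset rights Y.
Proof.
move=> yJ sat; split; apply/subsetP => w wy.
- have [y' /setD1P[neq y'J] wy'] := A_shared yJ wy.
  apply/bigcupP; exists y' => //; apply: contraLR sat => y'Y.
  apply/forall_inPn; exists y'; first by rewrite !inE negb_or neq y'Y.
  by rewrite negbK (meets_left wy' (setU11 _ _) wy).
- have [y' /setD1P[neq y'J] wy'] := B_shared yJ wy.
  apply/bigcupP; exists y' => //; apply: contraLR sat => y'Y.
  apply/forall_inPn; exists y'; first by rewrite !inE negb_or neq y'Y.
  by rewrite negbK (meets_right wy' (setU11 _ _) wy).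
Qed.

(** Induction along the greedy order. The conditional 2 is the debt incurred by opening a component
    and repaid when it is complete. *)
Lemma partial_biclique_bound (m : nat) : m <= #|J| ->
  exists Y : {set T}, [/\ Y \subset J, #|Y| = m &
    2 * #|lefts Y| + 2 * #|rights Y| <=
    #|edges Y| + 2 * m + (if saturated Y then 0 else 2)].
Proof.
elim: m => [_|m IHm mJ].
  exists set0; split; rewrite ?sub0set ?cards0 //.
  by rewrite /lefts /rights !big_set0 !cards0.
have [Y [YJ Ym bnd]] := IHm (ltnW mJ).
have [y [yJ yY meet]] : exists y, [/\ y \in J, y \notin Y &
    saturated Y || meets y Y].
  have [sat|/forall_inPn[y /setDP[yJ yY]]] := boolP (saturated Y); last first.
    by rewrite negbK => my; exists y; rewrite my orbT.
  have [|y yJ yY] := subsetPn (_ : ~~ (J \subset Y)); last by exists y.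
  by apply: contraL mJ => /subset_leq_card; rewrite Ym -leqNgt.
exists (y |: Y); split.
- by rewrite subUset sub1set yJ.
- by rewrite cardsU1 yY Ym.
have EE := edges_setU1 y Y; have EL := lefts_setU1 y Y.
have ER := rights_setU1 y Y.
have sA := subset_leq_card (subsetIl (A y) (lefts Y)).
have sB := subset_leq_card (subsetIl (B y) (rights Y)).
have sat' : saturated (y |: Y) ->
    #|A y :&: lefts Y| = #|A y| /\ #|B y :&: rights Y| = #|B y|.
  by move/(saturated_setU1 yJ) => [/setIidPl-> /setIidPl->].
have gain := biclique_gain (A_gt1 yJ) (B_gt1 yJ) sA sB.
have a1 := A_gt1 yJ; have b1 := B_gt1 yJ.
have [mt|nmt] := boolP (meets y Y).
  have {}gain := gain _.
  have st : 0 < #|A y :&: lefts Y| + #|B y :&: rights Y|.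
    by rewrite addn_gt0 !card_gt0.
  move/(_ st) in gain.
  (* If [y] completes a component, the vertex sets stay the same and the term 2 for the new graph
     repays the debt; otherwise [gain] suffices. *)
  case: (boolP (saturated (y |: Y))) sat' => [_ /(_ isT)[e1 e2]|_ _].
    by rewrite e1 e2 in EE EL ER; case: (saturated Y) bnd; lia.
  by case: (saturated Y) bnd; lia.
move: meet; rewrite (negPf nmt) orbF => satY; rewrite satY in bnd.
move: nmt; rewrite negb_or !negbK => /andP[/eqP s0 /eqP t0].
rewrite s0 t0 !cards0 in EE EL ER sat'.
(* A single graph never completes a component, as [A y] would then be empty. Opening one costs at
   most 2, since (a-2)(b-2) - 2 >= -2. *)
case: (boolP (saturated (y |: Y))) sat' => [_ /(_ isT)[e1 e2]|_ _].
  by move: a1; rewrite -e1.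
nia.
Qed.

Lemma biclique_bound :
  2 * #|lefts J| + 2 * #|rights J| <= #|edges J| + 2 * #|J|.
Proof.
have [Y [YJ Ym]] := partial_biclique_bound (leqnn _).
have {YJ Ym} -> : Y = J by apply/eqP; rewrite eqEcard YJ Ym leqnn.
have -> : saturated J by apply/forall_inP => y; rewrite setDv inE.
by rewrite addn0.
Qed.

End BicliqueCover.

(** * Covers and intermediate ranks *)

Section Ranks.
Variables (d : Order.disp_t) (P : finTBPOrderType d) (rho : P -> nat).

Lemma card_above_lt (x y : P) : (x < y)%O ->
  (#|[set t : P | (y < t)%O]| < #|[set t : P | (x < t)%O]|)%N.
Proof.
move=> xy; apply: proper_card; apply/properP; split.
  by apply/subsetP => t; rewrite !inE; apply: lt_trans.
by exists y; rewrite !inE ?ltxx.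
Qed.

(** Among the elements of (x, y], one with the fewest elements below it covers [x]. *)
Lemma covers_above (x y : P) :
  (x < y)%O -> exists2 z, covers z x & (z <= y)%O.
Proof.
move=> xy; have xyy : (x < y <= y)%O by rewrite xy lexx.
have [z /andP[xz zy] min] := @arg_minnP _ y (fun z => (x < z <= y)%O)
  (fun z => #|[set t : P | (t < z)%O]|) xyy.
exists z => //; rewrite /covers xz; apply/forallP => t.
apply/negP => /andP[xt tz].
have := min t; rewrite xt (le_trans (ltW tz) zy) => /(_ isT).
rewrite leqNgt => /negP; apply; apply: proper_card; apply/properP; split.
  by apply/subsetP => w; rewrite !inE => /lt_trans; apply.
by exists t; rewrite !inE ?ltxx.
Qed.

Hypothesis rho_rank : rank_function rho.

Lemma rank_covers (x y : P) : covers y x -> rho y = (rho x).+1.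
Proof. by case: rho_rank => _; apply. Qed.

(** Climbing from [x] by covers that stay below [y] raises the rank by one each time, so no rank is
    skipped. *)
Lemma rank_interpolate (x y : P) (r : nat) :
  (x <= y)%O -> (rho x <= r <= rho y)%N ->
  exists2 z, (x <= z <= y)%O & rho z = r.
Proof.
have [m] := ubnP #|[set t : P | (x < t)%O]|.
elim: m x => // m IHm x /ltnSE le_m xy /andP[xr ry].
have [->|neq] := eqVneq r (rho x); first by exists x; rewrite // lexx.
have {neq}xr : (rho x < r)%N by rewrite ltn_neqAle eq_sym neq.
have {}xy : (x < y)%O.
  by rewrite lt_neqAle xy andbT; apply: contraTneq ry => <-; rewrite -ltnNge.
have [w wx wy] := covers_above xy.
have xw : (x < w)%O by case/andP: wx.
have [| |z /andP[wz zy] <-] := IHm w _ wy.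
- exact: leq_trans (card_above_lt xw) le_m.
- by rewrite (rank_covers wx) xr.
by exists z => //; rewrite zy (le_trans (ltW xw)).
Qed.

Lemma rank_lt (x y : P) : (x < y)%O -> (rho x < rho y)%N.
Proof.
have [m] := ubnP #|[set t : P | (x < t)%O]|.
elim: m x => // m IHm x /ltnSE le_m xy; have [w wx] := covers_above xy.
have xw : (x < w)%O by case/andP: wx.
rewrite le_eqVlt => /predU1P[<-|wy]; first by rewrite (rank_covers wx).
rewrite ltnW // -(rank_covers wx) IHm //.
exact: leq_trans (card_above_lt xw) le_m.
Qed.

Lemma le_rank_lt (x y : P) : (x <= y)%O -> (rho x < rho y)%N -> (x < y)%O.
Proof.
by rewrite le_eqVlt => /predU1P[->|//]; rewrite ltnn.
Qed.

Lemma rank_interpolate_lt (x y : P) (r : nat) :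
  (x <= y)%O -> (rho x < r < rho y)%N ->
  exists2 z, (x < z < y)%O & rho z = r.
Proof.
move=> xy /andP[xr ry]; have [|z /andP[xz zy] zr] := @rank_interpolate _ _ r xy.
  by rewrite (ltnW xr) ltnW.
by exists z; rewrite // !le_rank_lt ?zr.
Qed.

End Ranks.

(** * Rank-two intervals and their consequences *)

Section Eulerian.
Variables (d : Order.disp_t) (P : finTBPOrderType d) (rho : P -> nat).
Hypothesis rho_eul : eulerian rho.
Let rho_rank : rank_function rho := proj1 rho_eul.

(** With m middle elements, each of Möbius value -1, the recursion reads 1 = -(1 - m). *)
Lemma eulerian_diamond (x y : P) : (x < y)%O -> rho y = (rho x).+2 ->
  #|[set z : P | (x < z < y)%O]| = 2%N.
Proof.
move=> xy rxy; have mu := proj2 rho_eul.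
have := mobius_lt xy; rewrite mu ?ltW // rxy.
rewrite (bigD1 x) /= ?lexx ?xy // mobius_refl.
under eq_bigl => z do rewrite andbAC (andbC (x <= z)%O) -lt_def.
rewrite (eq_bigr (fun=> -1)) => [|z /andP[xz zy]]; last first.
  have := rank_lt rho_rank xz; have := rank_lt rho_rank zy; rewrite rxy => h1 h2.
  by rewrite mu ?ltW // (_ : rho z - rho x = 1)%N //; lia.
rewrite sumr_const cardsE (_ : (rho x).+2 - rho x = 2)%N ?sqrrN ?expr1n; last lia.
by rewrite mulNrn natz; move: #|_| => m; lia.
Qed.

(** Inside [x, y], choose [u] one rank below [z] and [v] one rank above; the twin is the other
    middle element of [u, v]. *)
Lemma eulerian_twin (x y z : P) : (x < z < y)%O ->
  exists2 z', (x < z' < y)%O & rho z' = rho z /\ z' != z.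
Proof.
move=> /andP[xz zy].
have [rx ry] := (rank_lt rho_rank xz, rank_lt rho_rank zy).
have [|u /andP[xu uz] ru] :=
  rank_interpolate rho_rank (r := (rho z).-1) (ltW xz); first lia.
have [|v /andP[zv vy] rv] :=
  rank_interpolate rho_rank (r := (rho z).+1) (ltW zy); first lia.
have {}uz : (u < z)%O by apply: (le_rank_lt (rho := rho)) => //; lia.
have {}zv : (z < v)%O by apply: (le_rank_lt (rho := rho)) => //; lia.
have card2 : #|[set t : P | (u < t < v)%O]| = 2%N.
  by apply: eulerian_diamond; [apply: lt_trans zv | lia].
have : (0 < #|[set t : P | (u < t < v)%O] :\ z|)%N.
  by move: (cardsD1 z [set t : P | (u < t < v)%O]); rewrite card2 inE uz zv; lia.
rewrite card_gt0 => /set0Pn[w]; rewrite !inE => /and3P[wz uw wv].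
exists w; first by rewrite (le_lt_trans xu) // (lt_le_trans wv).
split=> //; have := rank_lt rho_rank uw; have := rank_lt rho_rank wv; lia.
Qed.

Lemma eulerian_interval_gt1 (x y : P) (r : nat) :
  (x <= y)%O -> (rho x < r < rho y)%N ->
  (1 < #|[set z : P | (rho z == r) && (x < z < y)%O]|)%N.
Proof.
move=> xy rxy; have [z xzy zr] := rank_interpolate_lt rho_rank xy rxy.
have [z' xzy' [zr' neq]] := eulerian_twin xzy.
by apply/card_gt1P; exists z', z; split; rewrite // inE ?zr' zr eqxx.
Qed.

End Eulerian.

(** * Flag numbers as counts of elements and of comparable pairs *)

Section FlagNumbers.
Variables (d : Order.disp_t) (P : finPOrderType d) (rho : P -> nat).

Lemma flag_f1 (i : nat) :
  flag_f rho [fset i]%fset = #|[set x | rho x == i]|.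
Proof.
(* The tuple length depends on this cardinal, so it is generalized before being replaced by 1. *)
rewrite /flag_f; move: #|` _| (cardfs1 i) => _ ->.
have inj : injective (fun x : P => [tuple x]) by move=> x y [].
rewrite -(card_imset _ inj); apply: eq_card => c; rewrite inE.
case/tupleP: c => x c; rewrite (tuple0 c) /=.
have -> : [fset rho t | t in [:: x]]%fset = [fset rho x]%fset.
  apply/fsetP => r; rewrite inE; apply/imfsetP/eqP => /= [[t]|->].
    by rewrite inE => /eqP->.
  by exists x; rewrite ?inE.
rewrite (inj_eq (@fset1_inj _)).
apply/idP/imsetP => [rx|[t]]; first by exists x; rewrite ?inE //; apply/val_inj.
by rewrite inE => tx /(congr1 val) [->].
Qed.

Lemma flag_f2_ge (i k : nat) : i != k ->
  (#|[set p : P * P | [&& rho p.1 == i, rho p.2 == k & (p.1 < p.2)%O]]| <=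
   flag_f rho [fset i; k]%fset)%N.
Proof.
move=> ik; rewrite /flag_f.
have : #|` [fset i; k]%fset| = 2%N by rewrite cardfs2 ik.
move: #|` _| => _ ->.
have inj : injective (fun p : P * P => [tuple p.1; p.2]).
  by move=> [x y] [x' y'] [-> ->].
rewrite -(card_imset _ inj); apply: subset_leq_card; apply/subsetP => c.
case/imsetP => -[x z]; rewrite inE /= => /and3P[/eqP xi /eqP zk xz] ->.
rewrite inE /= xz /=; apply/eqP/fsetP => r; rewrite !inE.
apply/imfsetP/orP => /= [[t]|].
  by rewrite !inE => /orP[]/eqP-> ->; rewrite ?xi ?zk eqxx; [left | right].
by case=> /eqP->; [exists x | exists z]; rewrite // !inE eqxx ?orbT.
Qed.

End FlagNumbers.

(** * The graphs attached to the elements of rank [j] *)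

Theorem theorem3p2 (n i j k : nat) (hn : (0 < n)%N)
    (hi : (1 <= i)%N) (hij : (i < j)%N) (hjk : (j < k)%N) (hk : (k <= n)%N)
    (d : Order.disp_t) (P : finTBPOrderType d) (rho : P -> nat)
    (hP : eulerian rho) (hrank : rho \top%O = n.+1) :
  0 <= (flag_f rho [fset i; k]%fset)%:Z - 2 * (flag_f rho [fset i]%fset)%:Z
       - 2 * (flag_f rho [fset k]%fset)%:Z + 2 * (flag_f rho [fset j]%fset)%:Z.
Proof.
have rho_rank : rank_function rho := proj1 hP.
have r0 : rho \bot%O = 0%N by case: rho_rank.
pose A (y : P) := [set x : P | (rho x == i) && (\bot < x < y)%O].
pose B (y : P) := [set z : P | (rho z == k) && (y < z < \top)%O].
pose J := [set y : P | rho y == j].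
have A1 : {in J, forall y, 1 < #|A y|}%N.
  move=> y; rewrite inE => /eqP yj.
  by apply: eulerian_interval_gt1; rewrite ?le0x // r0 yj hi.
have B1 : {in J, forall y, 1 < #|B y|}%N.
  move=> y; rewrite inE => /eqP yj.
  by apply: eulerian_interval_gt1; rewrite ?lex1 // yj hrank hjk.
(* The twin of [y] in the interval from [u] to the top is a second graph through [u]; dually for
   [Bs]. *)
have As : {in J, forall y u, u \in A y -> exists2 y', y' \in J :\ y & u \in A y'}.
  move=> y /[!inE] /eqP yj u /[!inE] /and3P[ui u0 uy].
  have [|y' /andP[uy' _] [ry' neq]] := eulerian_twin hP (y := \top%O) (x := u) (z := y).
    by rewrite uy (le_rank_lt (rho := rho)) ?lex1 // yj hrank; lia.
  by exists y'; rewrite !inE ?ui ?u0 ?uy' // neq ry' yj /=.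
have Bs : {in J, forall y v, v \in B y -> exists2 y', y' \in J :\ y & v \in B y'}.
  move=> y /[!inE] /eqP yj v /[!inE] /and3P[vk yv v1].
  have [|y' /andP[_ yv'] [ry' neq]] := eulerian_twin hP (x := \bot%O) (y := v) (z := y).
    by rewrite yv (le_rank_lt (rho := rho)) ?le0x // yj r0; lia.
  by exists y'; rewrite !inE ?vk ?v1 ?yv' // neq ry' yj /=.
have bound := biclique_bound A1 B1 As Bs.
(* Every element of rank [i] has one of rank [j] above it, so the graphs cover all of rank [i];
   dually for rank [k]. *)
have lowi : (#|[set x | rho x == i]| <= #|lefts A J|)%N.
  apply/subset_leq_card/subsetP => x; rewrite inE => /eqP xi.
  have [|y /andP[xy _] yj] :=
    rank_interpolate_lt rho_rank (r := j) (lex1 x); first by rewrite xi hrank; lia.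
  apply/bigcupP; exists y; rewrite !inE ?yj // xi eqxx xy andbT /=.
  by rewrite (le_rank_lt (rho := rho)) ?le0x // r0 xi.
have lowk : (#|[set z | rho z == k]| <= #|rights B J|)%N.
  apply/subset_leq_card/subsetP => z; rewrite inE => /eqP zk.
  have [|y /andP[_ yz] yj] :=
    rank_interpolate_lt rho_rank (r := j) (le0x z); first by rewrite zk r0; lia.
  apply/bigcupP; exists y; rewrite !inE ?yj // zk eqxx yz /=.
  by rewrite (le_rank_lt (rho := rho)) ?lex1 // hrank zk.
(* An edge comes from x < y < z, so its ends form a chain of ranks [i] and [k]. *)
have upe : (#|edges A B J| <= flag_f rho [fset i; k]%fset)%N.
  apply: leq_trans (flag_f2_ge rho _); last by rewrite neq_ltn (ltn_trans hij hjk).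
  apply/subset_leq_card/subsetP => -[x z] /bigcupP[y _]; rewrite !inE /=.
  by case/andP => /and3P[-> _ xy] /and3P[-> yz _]; rewrite (lt_trans xy yz).
rewrite !flag_f1 -/J; move: bound lowi lowk upe.
move: #|lefts A J| #|rights B J| #|edges A B J| #|J| (flag_f _ _) => l r e f fik.
by move: #|_| #|_| => fi fk; lia.
Qed.
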